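(* Suppose there exists an exponent $a>1$ such that $A:=\mathbb{E}^{\mathbb{P}}[\exp(\|\xi\|^a)]<\infty$, and let $\beta\in(0,1)$. Assume that $\widehat J_N$ and $\widehat x_N$ are the optimal value and an optimizer, respectively, of the distributionally robust program $$\widehat J_N=\inf_{x\in\mathbb{X}}\ \sup_{\mathbb{Q}\in\mathbb{B}_{\varepsilon_N(\beta)}(\widehat{\mathbb{P}}_N)}\mathbb{E}^{\mathbb{Q}}[h(x,\xi)],$$ with $\varepsilon_N(\beta)$ defined in the context. Then $$\mathbb{P}^N\Big\{\{\widehat\xi_i\}_{i\le N}\ :\ \mathbb{E}^{\mathbb{P}}[h(\widehat x_N,\xi)]\le \widehat J_N\Big\}\ \ge\ 1-\beta .$$
   Context: Setting: $\mathbb{X}\subseteq\mathbb{R}^n$ is a feasible set, $\Xi\subseteq\mathbb{R}^m$ an uncertainty set, $h:\mathbb{R}^n\times\mathbb{R}^m\to\overline{\mathbb{R}}=\mathbb{R}\cup\{\pm\infty\}$ a loss function (measurable in its second argument), and $\mathbb{P}$ a probability distribution supported on $\Xi$. The dimension satisfies $m\neq 2$. $\|\cdot\|$ is an arbitrary norm on $\mathbb{R}^m$. The training samples $\widehat\xi_1,\dots,\widehat\xi_N$ are independent with distribution $\mathbb{P}$, so the dataset is governed by the product distribution $\mathbb{P}^N$; the empirical distribution is $\widehat{\mathbb{P}}_N=\frac1N\sum_{i=1}^N\delta_{\widehat\xi_i}$. The quantities $\widehat J_N,\widehat x_N$ depend on the samples and are thus random. Expectations of extended-real functions are defined as $\mathbb{E}^{\mathbb{Q}}[\ell(\xi)]=\mathbb{E}^{\mathbb{Q}}[\max\{\ell(\xi),0\}]+\mathbb{E}^{\mathbb{Q}}[\min\{\ell(\xi),0\}]$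 with the convention $\infty-\infty=\infty$. Wasserstein metric: $\mathcal{M}(\Xi)$ is the set of probability distributions $\mathbb{Q}$ supported on $\Xi$ with $\mathbb{E}^{\mathbb{Q}}[\|\xi\|]<\infty$. For $\mathbb{Q}_1,\mathbb{Q}_2\in\mathcal{M}(\Xi)$, $d_{\mathrm W}(\mathbb{Q}_1,\mathbb{Q}_2)=\inf_\Pi\int_{\Xi^2}\|\xi_1-\xi_2\|\,\Pi(d\xi_1,d\xi_2)$, the infimum being over joint distributions $\Pi$ with marginals $\mathbb{Q}_1$ and $\mathbb{Q}_2$. For $\varepsilon\ge0$, $\mathbb{B}_\varepsilon(\widehat{\mathbb{P}}_N)=\{\mathbb{Q}\in\mathcal{M}(\Xi):d_{\mathrm W}(\widehat{\mathbb{P}}_N,\mathbb{Q})\le\varepsilon\}$. Constants and radius: by a known measure concentration theorem (Fournier and Guillin) there are positive constants $c_1,c_2$ depending only on $a$, $A$ and $m$ such that for all $N\ge1$ and $\varepsilon>0$, $$\mathbb{P}^N\{d_{\mathrm W}(\mathbb{P},\widehat{\mathbb{P}}_N)\ge\varepsilon\}\le\begin{cases}c_1\exp(-c_2N\varepsilon^{\max\{m,2\}})&\text{if }\varepsilon\le1,\\ c_1\exp(-c_2N\varepsilon^{a})&\text{if }\varepsilon>1.\end{cases}$$ With such constants fixed (this known result may be used), $$\varepsilon_N(\beta)=\begin{cases}\Big(\frac{\log(c_1\beta^{-1})}{c_2N}\Big)^{1/\max\{m,2\}}&\text{if }N\ge\frac{\log(c_1\beta^{-1})}{c_2},\\ \Big(\frac{\log(c_1\beta^{-1})}{c_2N}\Big)^{1/a}&\text{if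 }N<\frac{\log(c_1\beta^{-1})}{c_2}.\end{cases}$$ *)

(* Defs.v *)
From HB Require Import structures.
From mathcomp Require Import all_boot all_order all_algebra.
From mathcomp Require Import all_classical all_reals all_analysis.
From mathcomp Require Import measurable_realfun.

Set Implicit Arguments.
Unset Strict Implicit.
Unset Printing Implicit Defensive.
Import Order.TTheory GRing.Theory Num.Theory.
Import numFieldNormedType.Exports.

Local Open Scope classical_set_scope.
Local Open Scope ring_scope.

(* Row vectors carry their Borel sigma-algebra (the topology of 'rV[R]_m is
   that of any norm on R^m). *)
Section borel_rV.
Context (R : realType) (m : nat).
Local Notation borel := (@open 'rV[R]_m).

HB.instance Definition _ := @isMeasurable.Build (sigma_display borel) 'rV[R]_m
  <<s borel >> (@sigma_algebra0 _ setT borel) (@sigma_algebraC _ borel)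
  (@sigma_algebra_bigcup _ setT borel).

End borel_rV.

Definition is_norm (R : realType) (m : nat) (nrm : 'rV[R]_m -> R) : Prop :=
  [/\ forall x y, nrm (x + y) <= nrm x + nrm y,
      forall (c : R) x, nrm (c *: x) = `|c| * nrm x &
      forall x, nrm x = 0 -> x = 0].

Section power_probability.
Context d (T : measurableType d) (R : realType) (P : probability T R).

Definition tcons N (z : T * N.-tuple T) : N.+1.-tuple T := [tuple of z.1 :: z.2].

Lemma measurable_tcons N : measurable_fun setT (@tcons N).
Proof. exact: measurable_cons. Qed.

HB.instance Definition _ N :=
  @isMeasurableFun.Build _ _ _ _ (@tcons N) (@measurable_tcons N).

(* P^N; see power_probE. *)
Fixpoint power_prob (N : nat) : probability (N.-tuple T) R :=
  match N return probability (N.-tuple T) R with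
  | 0 => \d_([tuple])
  | N'.+1 => distribution (P \x power_prob N')%E (@tcons N')
  end.

Lemma power_probE N (B : 'I_N -> set T) : (forall i, measurable (B i)) ->
  power_prob N [set s | forall i, B i (tnth s i)] = (\prod_(i < N) P (B i))%E.
Proof.
elim: N B => [|N IH] B mB.
  by rewrite big_ord0 /= diracE mem_set// => -[].
rewrite big_ord_recl -IH//= /distribution /pushforward.
rewrite -product_measure1E//; last first.
  rewrite (_ : mkset _ =
      \bigcap_(i in setT) ((fun s => tnth s i) @^-1` B (lift ord0 i))).
    apply: fin_bigcap_measurable => // i _; rewrite -[X in measurable X]setTI.
    exact: measurable_tnth.
  by apply/seteqP; split=> s /= h i; [move=> _; exact: h | exact: h].
congr (_ _); apply/seteqP; split=> -[x s] /=.
  move=> h; split => [|i]; first by have := h ord0; rewrite /tcons tnth0.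
  by have := h (lift ord0 i); rewrite /tcons tnthS.
by move=> [h0 h] i; case: (unliftP ord0 i) => [j|] ->; rewrite /tcons ?tnthS ?tnth0.
Qed.

(* Events whose measurability is not known a priori are measured from the
   inside; this is P E when E is measurable. *)
Definition inner_prob (E : set T) : \bar R :=
  ereal_sup [set P B | B in [set B | measurable B /\ B `<=` E]].

End power_probability.

Section wasserstein_dro.
Context (R : realType) (m : nat) (nrm : 'rV[R]_m -> R).
Local Notation Rm := 'rV[R]_m.

(* The sum is the dual addition of extended reals: +oo - oo = +oo. *)
Definition expect (Q : probability Rm R) (l : Rm -> \bar R) : \bar R :=
  ((\int[Q]_xi maxe (l xi) 0)%E + (\int[Q]_xi mine (l xi) 0)%E)%dE.

(* Q belongs to M(Xi); Xi is not required to be measurable, and for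
   measurable Xi the first clause is Q Xi = 1. *)
Definition in_M (Xi : set Rm) (Q : probability Rm R) : Prop :=
  {ae Q, forall xi, Xi xi} /\ (\int[Q]_xi (nrm xi)%:E < +oo)%E.

(* When Q1 and Q2 are supported on Xi, so is every coupling on Xi * Xi. *)
Definition coupling (Q1 Q2 : {measure set Rm -> \bar R})
    (Pi : probability (Rm * Rm)%type R) : Prop :=
  forall B, measurable B -> Pi (B `*` setT) = Q1 B /\ Pi (setT `*` B) = Q2 B.

Definition wasserstein (Q1 Q2 : {measure set Rm -> \bar R}) : \bar R :=
  ereal_inf [set (\int[Pi]_z (nrm (z.1 - z.2))%:E)%E | Pi in coupling Q1 Q2].

Definition empirical (N : nat) (s : N.-tuple Rm) : {measure set Rm -> \bar R} :=
  mscale (N%:R^-1)%:nng (msum (fun i => \d_(nth 0 s i)) N).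

Definition wball (Xi : set Rm) (nu : {measure set Rm -> \bar R}) (eps : R) :
    set (probability Rm R) :=
  [set Q | in_M Xi Q /\ (wasserstein nu Q <= eps%:E)%E].

Definition worst_case (Xi : set Rm) (nu : {measure set Rm -> \bar R}) (eps : R)
    (l : Rm -> \bar R) : \bar R :=
  ereal_sup [set expect Q l | Q in wball Xi nu eps].

Definition exp_moment (a : R) (P : probability Rm R) : \bar R :=
  (\int[P]_xi (expR (nrm xi `^ a))%:E)%E.

(* The constants of the Fournier-Guillin theorem depend on P only through a, A
   and m: the same c1 and c2 serve all P with exponential moment A. The outer
   measure dispenses with the measurability of the distance in the sample. *)
Definition concentration_constants (a A c1 c2 : R) : Prop :=
  [/\ 0 < c1, 0 < c2 &
    forall P : probability Rm R, exp_moment a P = A%:E ->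
    forall (N : nat) (eps : R), (0 < N)%N -> 0 < eps ->
    ((power_prob P N)^*%mu
       [set s | eps%:E <= wasserstein P (empirical s)] <=
     (if eps <= 1 then c1 * expR (- (c2 * N%:R * eps ^+ maxn m 2))
      else c1 * expR (- (c2 * N%:R * eps `^ a)))%:E)%E].

End wasserstein_dro.

(* For beta > c1 the logarithm is negative and the roots are not meaningful;
   powR then makes the radius 1. *)
Definition wradius (R : realType) (m : nat) (a c1 c2 beta : R) (N : nat) : R :=
  let L := ln (c1 * beta^-1) in
  if L / c2 <= N%:R then (L / (c2 * N%:R)) `^ ((maxn m 2)%:R^-1)
  else (L / (c2 * N%:R)) `^ (a^-1).

(* Main.v *)
From HB Require Import structures.
Require Import Defs.
From mathcomp Require Import all_boot all_order all_algebra.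
From mathcomp Require Import all_classical all_reals all_analysis.
From mathcomp Require Import measurable_realfun.
Set Implicit Arguments.
Unset Strict Implicit.
Unset Printing Implicit Defensive.
Import Order.TTheory GRing.Theory Num.Theory.
Import numFieldNormedType.Exports.
Import HBNNSimple.
Local Open Scope classical_set_scope.
Local Open Scope ring_scope.

(** Write d for the distance between P and the empirical distribution and eps
    for the radius eps_N(beta), chosen so that the concentration bound at eps
    is at most beta. Hence, with probability at least 1 - beta, the law P itself
    lies in the Wasserstein ball around the empirical distribution; there
    E^P[h(xhat, xi)] is one of the values whose supremum is the worst case of
    xhat, and that worst case is J.

    At every r >= eps the concentration bound is at most beta
    ([concentration_le_level]). It bounds the outer probability of {d >= r} for
    r > 0 only, whereas the radius is 0 when beta = c1: the level eps itself is
    then out of reach and has to be approached from above.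
    The event to be excluded is {d > eps}, the increasing
    union of the events {d >= eps + 1/(j+1)}, and [inner_prob_ge_bigcup] passes
    to that union. Since neither these events nor {E^P[h(xhat, xi)] <= J} need
    be measurable, the bound goes from the outer probability of a set to the
    inner probability of its complement.

    It remains to see that P belongs to the ball whenever d <= eps: P has a
    finite first moment ([exp_moment_in_M]), the ball measures the distance
    from the empirical distribution to P while the concentration bound
    measures it from P ([wasserstein_sym_le]), and almost every sample lies
    in Xi ^ N ([power_prob_support]), which the properties of J and
    xhat presuppose. *)

(** Monotonicity holds for arbitrary nonnegative functions, because their
    integral is by definition the supremum over the simple functions below
    them. This spares any proof that the norm is Borel measurable. *)
Lemma le_ge0_integral d (T : measurableType d) (R : realType)
    (mu : {measure set T -> \bar R}) (f g : T -> \bar R) :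
  (forall x, (0 <= f x)%E) -> (forall x, (f x <= g x)%E) ->
  (\int[mu]_x f x <= \int[mu]_x g x)%E.
Proof.
move=> f0 fg; have g0 x : (0 <= g x)%E by exact: le_trans (f0 x) (fg x).
rewrite !ge0_integralTE//; apply: le_ereal_sup => _ [k kf <-].
by exists k => // x; exact: le_trans (kf x) (fg x).
Qed.

(** For nonmeasurable [f] this half of the change of variables survives: a
    simple function below [f] pulls back along [X] to a simple function below
    [f \o X], with the same integral. *)
Lemma integral_distribution_le d d' (T : measurableType d)
    (T' : measurableType d') (R : realType) (P : probability T R)
    (X : {mfun T >-> T'}) (f : T' -> \bar R) :
  (forall y, (0 <= f y)%E) ->
  (\int[distribution P X]_y f y <= \int[P]_x f (X x))%E.
Proof.
move=> f0; rewrite ge0_integralTE//; apply: ge_ereal_sup => _ [k kf <-].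
rewrite -integralT_nnsfun ge0_integral_distribution//=; last 2 first.
- exact/measurable_EFinP/measurable_funP.
- by move=> y; rewrite lee_fin.
apply: le_ge0_integral => x /=; first by rewrite lee_fin.
exact: kf.
Qed.

(** Outer measure is approximated from above by measurable supersets: the union
    of a countable cover is one of them. *)
Lemma mu_ext_lt_cover d (T : measurableType d) (R : realType)
    (mu : {measure set T -> \bar R}) (E : set T) (b : \bar R) :
  (mu^*%mu E < b)%E -> exists B, [/\ measurable B, E `<=` B & (mu B < b)%E].
Proof.
move=> /ereal_inf_lt[_ [F [mF EF] <-] Fb].
exists (\bigcup_k F k); split => //; first exact: bigcupT_measurable.
apply: le_lt_trans Fb; apply: measure_sigma_subadditive => //.
exact: bigcupT_measurable.
Qed.

(** Outer measure is continuous along increasing sequences of arbitrary sets. If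
    the [B j] are measurable supersets of the [E j] with measure almost
    minimal, then liminf [B j] contains every [E j] since these increase,
    and it is the increasing union of the [\bigcap_(k >= j) B k], each of
    measure at most that of [B j]. *)
Lemma inner_prob_ge_bigcup d (T : measurableType d) (R : realType)
    (P : probability T R) (E : (set T)^nat) (b : R) :
  nondecreasing_seq E -> (forall j, (P^*%mu (E j) <= b%:E)%E) ->
  ((1 - b)%:E <= inner_prob P (~` \bigcup_j E j))%E.
Proof.
move=> ndE Eb; apply/lee_addgt0Pr => e e0.
have /choice[B BP] j : exists B,
    [/\ measurable B, E j `<=` B & (P B < (b + e)%:E)%E].
  by apply: mu_ext_lt_cover; apply: le_lt_trans (Eb j) _; rewrite lte_fin ltrDl.
pose C j := \bigcap_(k in [set k | (j <= k)%N]) B k.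
have mC j : measurable (C j).
  by apply: bigcap_measurable => [|k _]; [exists j => /= | have [] := BP k].
have mUC : measurable (\bigcup_j C j) by exact: bigcupT_measurable.
have ndC : nondecreasing_seq C.
  by move=> i j ij; apply/subsetPset => x Cx k jk; apply: Cx; exact: leq_trans jk.
have PC : (P (\bigcup_j C j) <= (b + e)%:E)%E.
  have cvgC : P \o C @ \oo --> P (\bigcup_j C j).
    exact: nondecreasing_cvg_mu.
  rewrite -(cvg_lim _ cvgC)//; apply: lime_le; first by apply: cvgP cvgC.
  apply: nearW => j; have [mB _ /ltW] := BP j; apply: le_trans.
  by apply: le_measure; rewrite ?inE// => x; apply; exact: leqnn.
have EC : ~` (\bigcup_j C j) `<=` ~` \bigcup_j E j.
  apply: subsetC => x [j _ Ejx]; exists j => // k jk.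
  have [_ + _] := BP k; apply.
  by have /subsetPset := ndE _ _ jk; apply.
have : (P (~` \bigcup_j C j) <= inner_prob P (~` \bigcup_j E j))%E.
  by apply: ereal_sup_ubound; exists (~` \bigcup_j C j) => //; split => //; exact: measurableC.
rewrite probability_setC// => h.
apply: le_trans (leeD2r e%:E h).
move: PC; have /fineK <- := fin_num_measure P _ mUC.
rewrite -EFinB -EFinD !lee_fin => PC.
by rewrite -addrA lerD2l lerNl opprD opprK lerBlDr.
Qed.

Lemma inner_prob_le_full d (T : measurableType d) (R : realType)
    (P : probability T R) (E F G : set T) :
  measurable G -> P G = 1%E -> E `&` G `<=` F ->
  (inner_prob P E <= inner_prob P F)%E.
Proof.
move=> mG PG EGF; apply: ge_ereal_sup => _ [B [mB BE] <-].
apply: (@le_trans _ _ (P (B `&` G))); last first.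
  apply: ereal_sup_ubound; exists (B `&` G) => //; split.
    exact: measurableI.
  by move=> x [/BE Ex Gx]; exact: EGF.
have PGC : P (~` G) = 0%E by rewrite probability_setC// PG subee.
rewrite -[leRHS]adde0 -PGC.
have mBG : measurable (B `&` G) by exact: measurableI.
have mGC : measurable (~` G) by exact: measurableC.
apply: le_trans (measureU2 P mBG mGC).
apply: le_measure; rewrite ?inE//; first exact: measurableU.
by move=> x Bx; have [Gx|] := pselect (G x); [left|right].
Qed.

(** The set [D] of full measure need not be measurable, so that its power is
    approached from inside by the power of the complement of a null set. *)
Lemma power_prob_support d (T : measurableType d) (R : realType)
    (P : probability T R) (N : nat) (D : set T) :
  {ae P, forall x, D x} ->
  exists G : set (N.-tuple T), [/\ measurable G, power_prob P N G = 1%E &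
    G `<=` [set s | forall i, D (tnth s i)]].
Proof.
move=> [Z [mZ PZ DZ]].
exists [set s | forall i, (~` Z) (tnth s i)]; split.
- rewrite (_ : mkset _ = \bigcap_(i in setT) ((fun s => tnth s i) @^-1` (~` Z))).
    apply: fin_bigcap_measurable => // i _; rewrite -[X in measurable X]setTI.
    by apply: measurable_tnth => //; exact: measurableC.
  by apply/seteqP; split=> s /= h i; [move=> _; exact: h | exact: h].
- rewrite (power_probE P (B := fun=> ~` Z)); last by move=> _; exact: measurableC.
  rewrite big1// => i _; rewrite probability_setC// PZ sube0//.
- by move=> s h i; apply: contrapT => nD; apply: (h i); exact: DZ.
Qed.

Section norm.
Context (R : realType) (m : nat) (nrm : 'rV[R]_m -> R)
  (hnrm : is_norm nrm).

Lemma is_normN x : nrm (- x) = nrm x.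
Proof.
by case: hnrm => _ hZ _; rewrite -scaleN1r hZ normrN normr1 mul1r.
Qed.

Lemma is_norm_ge0 x : 0 <= nrm x.
Proof.
have [hD hZ _] := hnrm.
have := hD x (- x); rewrite subrr is_normN -(scale0r x) hZ normr0 mul0r.
by rewrite -mulr2n pmulrn_lge0.
Qed.

(** Exchanging the two factors turns a coupling of [Q1] and [Q2] into a
    coupling of [Q2] and [Q1] with no larger transport cost. *)
Lemma wasserstein_sym_le (Q1 Q2 : {measure set 'rV[R]_m -> \bar R}) :
  (wasserstein nrm Q2 Q1 <= wasserstein nrm Q1 Q2)%E.
Proof.
apply: le_ereal_inf_tmp => _ [Pi Pi12 <-].
pose sw : 'rV[R]_m * 'rV[R]_m -> 'rV[R]_m * 'rV[R]_m := fun z => (z.2, z.1).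
have msw : measurable_fun setT sw by exact: measurable_swap.
pose X : {mfun _ >-> _} := HB.pack sw (isMeasurableFun.Build _ _ _ _ sw msw).
apply: (@le_trans _ _ (\int[distribution Pi X]_z (nrm (z.1 - z.2))%:E)%E).
  apply: ereal_inf_lbound; exists (distribution Pi X) => // B mB.
  have [h1 h2] := Pi12 B mB.
  split.
    rewrite -h2 /distribution /pushforward; congr (Pi _).
    by apply/seteqP; split=> -[u v] /=; tauto.
  rewrite -h1 /distribution /pushforward; congr (Pi _).
  by apply/seteqP; split=> -[u v] /=; tauto.
apply: le_trans.
  apply: integral_distribution_le => z; rewrite lee_fin; exact: is_norm_ge0.
apply: le_ge0_integral => z; rewrite lee_fin /=; first exact: is_norm_ge0.
by rewrite -is_normN opprB.
Qed.

(** The first moment is finite because t <= 1 + t `^ a <= expR (t `^ a) for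
    every t >= 0. *)
Lemma exp_moment_in_M (Xi : set 'rV[R]_m) (P : probability 'rV[R]_m R) (a : R) :
  1 <= a -> {ae P, forall xi, Xi xi} -> (exp_moment nrm a P < +oo)%E ->
  in_M nrm Xi P.
Proof.
move=> a1 PXi PA; split => //.
apply: le_lt_trans PA; apply: le_ge0_integral => x.
  by rewrite lee_fin; exact: is_norm_ge0.
rewrite lee_fin.
apply: le_trans (expR_ge1Dx _).
have [x1|/ltW x1] := leP (nrm x) 1.
  by apply: le_trans x1 _; rewrite lerDl powR_ge0.
by apply: le_trans (le1r_powR x1 a1) _; rewrite lerDr.
Qed.

End norm.

Lemma powRVK (R : realType) (x y : R) :
  0 <= x -> y != 0 -> (x `^ y^-1) `^ y = x.
Proof. by move=> x0 y0; rewrite -powRrM mulVf// powRr1. Qed.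

(** Put t = ln (c1 / beta) / (c2 * N), so that beta = c1 * exp (- c2 * N * t).
    The rate of the bound, r ^ max(m, 2) for r <= 1 and r `^ a for r > 1,
    increases with r and is equal to t at the radius when t >= 0, since t <= 1
    selects the root that matches r <= 1. For t < 0 every rate
    exceeds t, whatever the radius. *)
Lemma concentration_le_level (R : realType) (m N : nat) (a c1 c2 beta r : R) :
  (0 < N)%N -> 0 < a -> 0 < c1 -> 0 < c2 -> 0 < beta ->
  wradius m a c1 c2 beta N <= r ->
  (if r <= 1 then c1 * expR (- (c2 * N%:R * r ^+ maxn m 2))
   else c1 * expR (- (c2 * N%:R * r `^ a))) <= beta.
Proof.
move=> N0 a0 c10 c20 b0; rewrite /wradius.
set L := ln _; set k := maxn m 2; set t := L / (c2 * N%:R) => rle.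
have cN0 : 0 < c2 * N%:R by rewrite mulr_gt0// ltr0n.
have k0 : (k%:R : R) != 0 by rewrite pnatr_eq0 -lt0n leq_max orbT.
have r0 : 0 <= r by apply: le_trans rle; case: ifP => _; exact: powR_ge0.
have tE : (L / c2 <= N%:R) = (t <= 1).
  by rewrite /t ler_pdivrMr// ler_pdivrMr// mul1r mulrC.
rewrite tE in rle.
have betaE : beta = c1 * expR (- (c2 * N%:R * t)).
  rewrite /t mulrCA divff ?gt_eqF// mulr1 expRN lnK ?posrE ?mulr_gt0 ?invr_gt0//.
  by rewrite invfM invrK mulrA divff ?gt_eqF// mul1r.
suff tr : t <= (if r <= 1 then r ^+ k else r `^ a).
  rewrite [leRHS]betaE; case: ifP tr => _ tr;
  by rewrite ler_pM2l// ler_expR lerN2 ler_pM2l.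
have [t0|t0] := leP t 0.
  by apply: le_trans t0 _; case: ifP => _; [exact: exprn_ge0|exact: powR_ge0].
case: ifPn => r1.
  have t1 : t <= 1.
    have [//|t1] := leP t 1; move: rle; rewrite (leNgt t) t1/= => /le_trans/(_ r1).
    have : 1 `^ a^-1 < t `^ a^-1.
      by rewrite gt0_ltr_powR// ?invr_gt0// nnegrE ?ler01 ?ltW.
    by rewrite powR1 ltNge => /negbTE ->.
  rewrite t1 in rle.
  rewrite -powR_mulrn// -(powRVK (ltW t0) k0).
  by rewrite ge0_ler_powR// nnegrE powR_ge0.
have {}r1 : 1 < r by rewrite ltNge.
have [t1|t1] := leP t 1.
  by apply: le_trans t1 _; rewrite -[leLHS](powRr0 r) ler_powR// ltW.
move: rle; rewrite (leNgt t) t1/= => rle.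
rewrite -(powRVK (ltW t0) (lt0r_neq0 a0)).
by rewrite ge0_ler_powR// ?nnegrE ?powR_ge0// ltW.
Qed.

Theorem theorem3p5 (R : realType) (n m N : nat) (hm : m <> 2%N) (hN : (0 < N)%N)
  (nrm : 'rV[R]_m -> R) (hnrm : is_norm nrm)
  (X : set 'rV[R]_n) (Xi : set 'rV[R]_m)
  (h : 'rV[R]_n -> 'rV[R]_m -> \bar R)
  (hh : forall x, measurable_fun setT (h x))
  (P : probability 'rV[R]_m R) (hP : {ae P, forall xi, Xi xi})
  (a A : R) (ha : 1 < a) (hA : exp_moment nrm a P = A%:E)
  (c1 c2 : R) (hc : concentration_constants nrm a A c1 c2)
  (beta : R) (hbeta : 0 < beta < 1)
  (J : N.-tuple 'rV[R]_m -> \bar R) (xhat : N.-tuple 'rV[R]_m -> 'rV[R]_n)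
  (hJ : forall s, (forall i, Xi (tnth s i)) ->
    J s = ereal_inf [set worst_case nrm Xi (empirical s)
                           (wradius m a c1 c2 beta N) (h x) | x in X])
  (hxhat : forall s, (forall i, Xi (tnth s i)) ->
    X (xhat s) /\
    worst_case nrm Xi (empirical s) (wradius m a c1 c2 beta N) (h (xhat s)) = J s) :
  ((1 - beta)%:E <=
   inner_prob (power_prob P N) [set s | expect P (h (xhat s)) <= J s])%E.
Proof.
have /andP[b0 b1] := hbeta; have [c10 c20 conc] := hc.
have a0 : 0 < a by exact: lt_trans ha.
set eps := wradius m a c1 c2 beta N in hJ hxhat *.
have eps0 : 0 <= eps by rewrite /eps /wradius; case: ifP => _; exact: powR_ge0.
pose E (j : nat) : set (N.-tuple 'rV[R]_m) :=
  [set s | ((eps + j.+1%:R^-1)%:E <= wasserstein nrm P (empirical s))%E].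
have ndE : nondecreasing_seq E.
  move=> i j ij; apply/subsetPset => s; apply: le_trans.
  by rewrite lee_fin lerD2l lef_pV2 ?posrE ?ltr0n// ler_nat.
have PE j : ((power_prob P N)^*%mu (E j) <= beta%:E)%E.
  have r0 : 0 < eps + j.+1%:R^-1 by rewrite ltr_wpDl// invr_gt0 ltr0n.
  apply: le_trans (conc P hA N _ hN r0) _.
  rewrite lee_fin; apply: concentration_le_level => //.
  by rewrite lerDl invr_ge0 ler0n.
have [G [mG PG GXi]] := power_prob_support N hP.
apply: le_trans (inner_prob_ge_bigcup ndE PE) _.
apply: (inner_prob_le_full mG PG) => s [nEs /GXi sXi].
have [Xx wJ] := hxhat s sXi.
rewrite /= -wJ; apply: ereal_sup_ubound; exists P => //; split.
  by apply: (exp_moment_in_M hnrm (ltW ha)) => //; rewrite hA ltry.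
apply: le_trans (wasserstein_sym_le hnrm _ _) _.
apply/lee_addgt0Pr => e e0; rewrite leNgt; apply/negP => lt_e.
(* If the distance exceeded eps + e, it would exceed eps + 1 / (j + 1) as soon
   as 1 / e < j + 1. *)
apply: nEs; exists (Num.truncn e^-1) => //.
rewrite /E /=; apply: le_trans (ltW lt_e).
rewrite -EFinD lee_fin lerD2l -[leRHS]invrK lef_pV2 ?posrE ?ltr0n ?invr_gt0//.
by apply/ltW; exact: truncnS_gt.
Qed.
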